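(* Let $\mathfrak{K}$ be a class of infinite linear orders and $\nu$ an effective enumeration of $\mathfrak{K}$. If $\mathfrak{C}\subseteq\mathfrak{K}$ contains infinitely many pairwise non-isomorphic members, then $\mathfrak{C}$ is not $\mathbf{InfEx}_{\cong}[\nu]$-learnable.
   Context: Classes are closed under isomorphism among structures with domain $\omega$; linear orders are in the signature $\{\le\}$. For $L=\{P_0^{n_0},\dots,P_k^{n_k}\}$, an $L$-informant is $I$ on $\omega$ with $I(m)=(I_0(m),\dots,I_k(m))$, $I_j(m)\in\omega^{n_j}\times\{0,1\}$; it is an informant for $\mathcal{S}$ if for every $j$, $\mathrm{range}(I_j)=\{(\bar a,1):\bar a\in P_j^{\mathcal{S}}\}\cup\{(\bar a,0):\bar a\notin P_j^{\mathcal{S}}\}$; $I[n]=I(0),\dots,I(n-1)$. A learner is an arbitrary function from finite initial segments of informants to $\omega\cup\{?\}$. An effective enumeration of $\mathfrak{K}$ is $\nu:\omega\to\mathfrak{K}$ with $(\nu(e))_e$ uniformly computable and every member of $\mathfrak{K}$ isomorphic to some $\nu(e)$. $\mathfrak{C}$ is $\mathbf{InfEx}_{\cong}[\nu]$-learnable if some learner $M$ satisfies: for every $\mathcal{A}\in\mathfrak{C}$ and every informant $I$ for $\mathcal{A}$ there are $e,s_0$ with $\nu(e)\cong\mathcal{A}$ and $M(I[s])=e$ for all $s\ge s_0$. *)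

(* Defs.v *)
From mathcomp Require Import all_boot.

Set Implicit Arguments.
Unset Strict Implicit.
Unset Printing Implicit Defensive.

(** * Computable relations on [nat] (mu-recursive functions) *)

Inductive recfun : nat -> Type :=
| RZero n : recfun n
| RSucc : recfun 1
| RProj n : 'I_n -> recfun n
| RComp n m : recfun m -> ('I_m -> recfun n) -> recfun n
| RPrec n : recfun n -> recfun n.+2 -> recfun n.+1
| RMin n : recfun n.+1 -> recfun n.

(* [reval c v y]: the partial function coded by [c] is defined at [v] with
   value [y].  In [RPrec], [s] lists the successive values of the recursion,
   whose recursion argument comes first. *)
Fixpoint reval n (c : recfun n) : n.-tuple nat -> nat -> Prop :=
  match c in recfun n return n.-tuple nat -> nat -> Prop with
  | RZero n => fun _ y => y = 0
  | RSucc => fun v y => y = (thead v).+1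
  | RProj n i => fun v y => y = tnth v i
  | RComp n m f g => fun v y =>
      exists w : m.-tuple nat,
        (forall i, reval (g i) v (tnth w i)) /\ reval f w y
  | RPrec n f g => fun v y =>
      let p : n.-tuple nat := [tuple of behead v] in
      exists s : nat -> nat,
        [/\ reval f p (s 0),
            forall k, k < thead v -> reval g [tuple of k :: s k :: p] (s k.+1)
          & y = s (thead v)]
  | RMin n f => fun v y =>
      reval f [tuple of y :: v] 0 /\
      forall z, z < y -> exists u, reval f [tuple of z :: v] u.+1
  end.

Definition computable_rel n (R : n.-tuple nat -> Prop) : Prop :=
  exists c : recfun n, forall v,
    (R v -> reval c v 1) /\ (~ R v -> reval c v 0).

(** * Relational structures with domain [nat] *)

(* The language {P_0, ..., P_k}, with [arity j] the arity of P_j. *)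
Record signature := Signature { top_index : nat;
                                arity : 'I_top_index.+1 -> nat }.
Arguments arity : clear implicits.

Definition structure (L : signature) : Type :=
  forall j, (arity L j).-tuple nat -> Prop.

Definition iso (L : signature) (A B : structure L) : Prop :=
  exists2 f : nat -> nat, bijective f &
    forall j (a : (arity L j).-tuple nat), A j a <-> B j [tuple of map f a].

Definition iso_closed (L : signature) (K : structure L -> Prop) : Prop :=
  forall A B, iso A B -> K A -> K B.

(* There are finitely many symbols, so uniformity is only needed in [e]. *)
Definition uniformly_computable (L : signature) (nu : nat -> structure L) :
    Prop :=
  forall j, computable_rel
    (fun v : (arity L j).+1.-tuple nat => nu (thead v) j [tuple of behead v]).

Definition effective_enumeration (L : signature) (K : structure L -> Prop)
    (nu : nat -> structure L) : Prop :=
  [/\ forall e, K (nu e),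
      uniformly_computable nu
    & forall A, K A -> exists e, iso A (nu e)].

(** * Learning from informants *)

Definition observation (L : signature) : Type :=
  forall j, (arity L j).-tuple nat * bool.

Definition is_informant (L : signature) (I : nat -> observation L)
    (A : structure L) : Prop :=
  forall j (a : (arity L j).-tuple nat) (b : bool),
    (exists m, I m j = (a, b)) <-> (if b then A j a else ~ A j a).

(* [None] is the answer "?".  Every finite sequence of observations is an
   initial segment of some informant in the signature. *)
Definition learner (L : signature) : Type := seq (observation L) -> option nat.

Definition InfEx_learnable (L : signature) (nu : nat -> structure L)
    (C : structure L -> Prop) : Prop :=
  exists M : learner L, forall A, C A ->
    forall I, is_informant I A ->
    exists e s0, iso (nu e) A /\ forall s, s0 <= s -> M (mkseq I s) = Some e.

(** * Linear orders *)

Definition order_sig : signature := @Signature 0 (fun=> 2).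

Definition order_rel (A : structure order_sig) (x y : nat) : Prop :=
  A ord0 [tuple x; y].

(* The domain is [nat], so such an order is infinite. *)
Definition is_linear_order (A : structure order_sig) : Prop :=
  [/\ forall x, order_rel A x x,
      forall x y, order_rel A x y -> order_rel A y x -> x = y,
      forall x y z, order_rel A x y -> order_rel A y z -> order_rel A x z
    & forall x y, order_rel A x y \/ order_rel A y x].

(* Main.v *)
Require Import Defs.
From mathcomp Require Import all_boot zify.
From mathcomp Require Import boolp.

Set Implicit Arguments.
Unset Strict Implicit.
Unset Printing Implicit Defensive.

(** Feeding a learner the canonical informants of the copies of a member [A]
of the class, a Baire category argument yields a finite tuple of [A] that
locks the learner: on every copy of [A] extending the tuple the answers are
constant from some stage on.  The tuple can be enlarged until each interval it
determines is empty or infinite, so that it becomes a word over "point" and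
"free gap".  By Higman's lemma, among infinitely many members two have words
such that the second arises from the first by replacing the free gaps by
arbitrary words.  The second order [B] then contains a tuple all of whose
intervals are no larger than those of the locking tuple of [A], so every finite
extension of it in [B] has the same order type as an extension in [A].  Hence
the learner gives the same final answer on a copy of [B] as on the copies of
[A], and [A] and [B] are isomorphic. *)

(** * Subsequences of sequences of natural numbers *)

(** Choosing again and again a position where [f] is minimal on the remaining tail yields values
    that bound all later values of [f] from below, not only those along [g]. *)
Lemma nondecreasing_subsequence (f : nat -> nat) :
  exists g : nat -> nat, {homo g : i j / i < j} /\
    forall i k, g i <= k -> f (g i) <= f k.
Proof.
have step n : exists m, n <= m /\ forall k, m <= k -> f m <= f k.
  have exP : exists y, `[< exists2 m, n <= m & f m = y >].
    by exists (f n); apply/asboolP; exists n.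
  case: (ex_minnP exP) => y /asboolP[m nm <-] min_m.
  exists m; split=> // k mk; apply: min_m; apply/asboolP; exists k => //.
  exact: leq_trans mk.
have [h hP] := choice step.
pose g := fix g n := if n is n'.+1 then h (g n').+1 else h 0.
exists g; split.
  by apply: homo_ltn => [? ? ?|i]; [exact: ltn_trans|case: (hP (g i).+1)].
by case=> [|i] k /= gk; apply: (proj2 (hP _)).
Qed.

(** * Higman's lemma *)

Section Higman.

Variable R : seq nat -> seq nat -> Prop.
Hypothesis R_nil : forall w, R [::] w.
Hypothesis R_skip : forall v w k, R v w -> R v (k :: w).
Hypothesis R_cons : forall v w k l, k <= l -> R v w -> R (k :: v) (l :: w).

Let bad (f : nat -> seq nat) := forall i j, i < j -> ~ R (f i) (f j).

(* Nash-Williams: each term is chosen of least length among the bad sequences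
   that extend the terms already chosen. *)
Let minimal_bad_sequence f : bad f -> exists2 F, bad F &
  forall n f', bad f' -> (forall i, i < n -> f' i = F i) ->
    size (F n) <= size (f' n).
Proof.
move=> bad_f.
(* [E p]: the list [p] is an initial segment of some bad sequence. *)
pose E p := exists2 f', bad f' & mkseq f' (size p) = p.
have step p : exists w, E p ->
    E (rcons p w) /\ forall w', E (rcons p w') -> size w <= size w'.
  case: (pselect (E p)) => [Ep|nEp]; last by exists [::].
  have exP : exists k, `[< exists2 w, E (rcons p w) & size w = k >].
    case: Ep => f' bad_f' pE; exists (size (f' (size p))); apply/asboolP.
    exists (f' (size p)) => //; exists f' => //.
    by rewrite size_rcons mkseqS pE.
  case: (ex_minnP exP) => y /asboolP[w Ew <-] min_w.
  exists w => _; split=> // w' Ew'; apply: min_w; apply/asboolP.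
  by exists w'.
have [next nextP] := choice step.
pose P := fix P n := if n is n'.+1 then rcons (P n') (next (P n')) else [::].
have EP n : E (P n).
  by elim: n => [|n IH]; [exists f|case: (nextP _ IH)].
have PE n : P n = mkseq (next \o P) n.
  by elim: n => // n IH; rewrite mkseqS -IH.
exists (next \o P) => [i j ij|n f' bad_f' f'E].
  have [f' bad_f'] := EP j.+1; rewrite PE size_mkseq => f'E.
  have nthE k : k < j.+1 -> f' k = (next \o P) k.
    by move=> kj; rewrite -(nth_mkseq [::] f' kj) f'E nth_mkseq.
  by rewrite -(nthE i) ?ltnS 1?ltnW // -nthE //; apply: bad_f'.
apply: (proj2 (nextP _ (EP n))); exists f' => //.
rewrite size_rcons mkseqS PE size_mkseq; congr rcons.
by apply/eq_in_map => i; rewrite mem_iota add0n => /f'E.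
Qed.

(** In a minimal bad sequence no term is empty. Keep the terms before [g 0] and continue with the
    tails of the terms along [g], whose heads do not decrease: the result is still bad, but shorter
    at [g 0]. *)
Lemma higman (f : nat -> seq nat) : exists i j, i < j /\ R (f i) (f j).
Proof.
apply: contrapT => noR.
have /minimal_bad_sequence[F bad_F min_F] : bad f.
  by move=> i j ij Rij; apply: noR; exists i, j.
have F_cons n : F n = head 0 (F n) :: behead (F n).
  by case E: (F n) => //; case: (bad_F n n.+1 (ltnSn n)); rewrite E.
have [g [g_homo g_min]] := nondecreasing_subsequence (head 0 \o F).
have g_le i j : i <= j -> g i <= g j by rewrite leq_eqVlt => /predU1P[->//|/g_homo/ltnW].
pose f' i := if i < g 0 then F i else behead (F (g (i - g 0))).
have bad_f' : bad f'.
  move=> i j ij; rewrite /f'; case: ltnP => ig; case: ltnP => jg.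
  - exact: bad_F.
  - move=> /(R_skip (head 0 (F (g (j - g 0))))); rewrite -F_cons; apply: bad_F.
    exact: leq_trans ig (g_le _ _ _).
  - lia.
  have ij' : g (i - g 0) < g (j - g 0) by apply: g_homo; lia.
  move=> /(R_cons (g_min _ _ (ltnW ij'))); rewrite /= -!F_cons.
  exact: bad_F.
have := min_F (g 0) f' bad_f'.
have -> : f' (g 0) = behead (F (g 0)) by rewrite /f' ltnn subnn.
by rewrite {1}F_cons /= ltnn => H; apply/notF/H => i ig; rewrite /f' ig.
Qed.

End Higman.

(** * Absorption between words of points and free gaps *)

(* In a word, [true] stands for a point and [false] for a free gap.
   [absorbs c d]: replacing each [false] of [c] by some word gives [d]. *)
Inductive absorbs : seq bool -> seq bool -> Prop :=
| absorbs_nil : absorbs [::] [::]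
| absorbs_cons b c d : absorbs c d -> absorbs (b :: c) (b :: d)
| absorbs_drop c d : absorbs c d -> absorbs (false :: c) d
| absorbs_skip b c d : absorbs (false :: c) d -> absorbs (false :: c) (b :: d).

Lemma absorbs_cat w c d : absorbs c d -> absorbs (w ++ c) (w ++ d).
Proof. by move=> cd; elim: w => //= b w; apply: absorbs_cons. Qed.

Lemma absorbs_skips w c d :
  absorbs (false :: c) d -> absorbs (false :: c) (w ++ d).
Proof. by move=> cd; elim: w => //= b w; apply: absorbs_skip. Qed.

(** The leading gap absorbs the surplus [l - k] points together with the gap in front of them. *)
Lemma absorbs_free k l c d : k <= l -> absorbs c d ->
  absorbs (false :: nseq k true ++ c) (false :: nseq l true ++ d).
Proof.
move=> /subnK <- cd; rewrite nseqD -catA; apply: absorbs_skip.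
by apply: absorbs_skips; apply: absorbs_drop; apply: absorbs_cat.
Qed.

(** Each run in [ks] is followed by a further gap; the final run [k] is not, and has to be matched
    with a final run. *)
Fixpoint free_word (ks : seq nat) (k : nat) : seq bool :=
  if ks is k1 :: ks' then false :: nseq k1 true ++ free_word ks' k
  else false :: nseq k true.

Lemma word_decomposition c : (exists k, c = nseq k true) \/
  exists k0 ks k, c = nseq k0 true ++ free_word ks k.
Proof.
elim: c => [|[] c [[k ->]|[k0 [ks [k ->]]]]]; first by left; exists 0.
- by left; exists k.+1.
- by right; exists k0.+1, ks, k.
- by right; exists 0, [::], k.
- by right; exists 0, (k0 :: ks), k.
Qed.

Lemma free_word_cons ks k : exists c, free_word ks k = false :: c.
Proof. by case: ks => [|k1 ks] /=; eexists. Qed.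

(** Words of points alone absorb only themselves, hence the hypothesis. Any other word consists of a
    first run, inner runs and a last run; pass to a subsequence along which the first and the last
    runs do not decrease, and apply Higman's lemma to the inner runs. *)
Lemma absorbs_good (c : nat -> seq bool) :
  (forall n k, c n <> nseq k true) ->
  exists i j, i < j /\ absorbs (c i) (c j).
Proof.
move=> c_free.
have /choice[d dP] n : exists d : nat * seq nat * nat,
    c n = nseq d.1.1 true ++ free_word d.1.2 d.2.
  case: (word_decomposition (c n)) => [[k /c_free//]|[k0 [ks [k ->]]]].
  by exists (k0, ks, k).
have [g [g_homo g_min]] := nondecreasing_subsequence (fun n => (d n).1.1).
have [h [h_homo h_min]] := nondecreasing_subsequence (fun n => (d (g n)).2).
(* The last runs are quantified inside [R], which thus compares inner runs only. *)
pose R v w := forall k l, k <= l -> absorbs (free_word v k) (free_word w l).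
have [|||i [j [ij Rij]]] := @higman R _ _ _ (fun n => (d (g (h n))).1.2).
- move=> w k l kl; elim: w => [|k1 w IH] /=.
    by have := absorbs_free kl absorbs_nil; rewrite !cats0.
  by rewrite -cat_cons; apply: absorbs_skips.
- move=> v w k1 Rvw k l /Rvw /=; have [x ->] := free_word_cons v k.
  by rewrite -cat_cons; apply: absorbs_skips.
- by move=> v w k1 l1 kl1 Rvw k l /Rvw; apply: absorbs_free.
exists (g (h i)), (g (h j)); have hij := h_homo _ _ ij.
split; first exact: g_homo.
rewrite !dP -(subnKC (g_min (h i) (g (h j)) (ltnW (g_homo _ _ hij)))).
rewrite nseqD -catA; apply: absorbs_cat.
have := Rij _ _ (h_min _ _ (ltnW hij)).
by have [x ->] := free_word_cons (d (g (h i))).1.2 (d (g (h i))).2; apply: absorbs_skips.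
Qed.

(** * Words realized in a linear order *)

Section Words.

Variable lt : rel nat.
Hypothesis lt_irr : irreflexive lt.
Hypothesis lt_trans : transitive lt.
Hypothesis lt_total : forall x y, x != y -> lt x y || lt y x.

(* A free gap skips an initial segment of [I] on which [Q] holds; since [J] is
   only required to be upward closed, it need not have an endpoint. *)
Fixpoint realizes (Q : pred nat -> Prop) (I : pred nat) (c : seq bool)
    (a : seq nat) : Prop :=
  match c with
  | [::] => a = [::] /\ I =1 xpred0
  | true :: c' => exists x a',
      [/\ a = x :: a', I x, forall y, I y -> ~~ lt y x
        & realizes Q [pred y | I y && lt x y] c' a']
  | false :: c' => exists J : pred nat,
      [/\ subpred J I, forall x y, J x -> I y -> lt x y -> J y,
          Q [pred x | I x && ~~ J x] & realizes Q J c' a]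
  end.

(** For a subset of a linear order this means being infinite, in the form that the matching of
    tuples uses. *)
Definition unbounded (I : pred nat) : Prop :=
  forall n, exists s, [/\ size s = n, pairwise lt s & all I s].

Lemma realizes_weaken (Q : pred nat -> Prop) I c a :
  realizes Q I c a -> realizes (fun=> True) I c a.
Proof.
elim: c I a => [|[] c IH] I a //=.
  by move=> [x [a' [-> Ix minx /IH]]]; exists x, a'.
by move=> [J [JI Jup _ /IH]]; exists J.
Qed.

Lemma realizes_pairwise (Q : pred nat -> Prop) I c a :
  realizes Q I c a -> pairwise lt a /\ all I a.
Proof.
elim: c I a => [|[] c IH] I a /=.
- by case=> ->.
- case=> x [a' [-> Ix _ /IH[pa' /allP Ia']]] /=.
  rewrite pa' Ix andbT /=; split; last by apply/allP => y /Ia' /andP[].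
  by apply/allP => y /Ia' /andP[].
- by case=> J [JI _ _ /IH[-> /allP Ja]]; split=> //; apply/allP => y /Ja/JI.
Qed.

(** Each [true] accounts for the least remaining element, so a word without gaps bounds the size of
    [I]. *)
Lemma realizes_size (Q : pred nat -> Prop) I k a s :
  realizes Q I (nseq k true) a -> pairwise lt s -> all I s -> size s <= k.
Proof.
elim: k I a s => [|k IH] I a s /=.
  by case=> _ I0; case: s => //= x s _; rewrite I0.
case=> x [a' [_ Ix minx /IH{}IH]]; case: s => //= y s /andP[ys ps] /andP[Iy Is].
apply: IH => //; apply/allP => z zs /=; rewrite (allP Is) //=.
have yz := allP ys _ zs; have := minx _ Iy.
have [->|/lt_total/orP[xy|->//]] := eqVneq x y; first by rewrite yz.
by rewrite (lt_trans xy yz).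
Qed.

(** The part of the order described by a replacing word in [d] is merged into one gap of [c], of
    which no size is asked. *)
Lemma realizes_absorbs c d I b : absorbs c d ->
  realizes (fun=> True) I d b -> exists b', realizes (fun=> True) I c b'.
Proof.
move=> cd; elim: cd I b => {c d} [|[] c d _ IH|c d _ IH|b0 c d _ IH] I b /=.
- by exists b.
- by case=> x [b' [_ Ix minx /IH[b'' H]]]; exists (x :: b''), x, b''.
- by case=> J [JI Jup _ /IH[b' H]]; exists b', J.
- by move=> /IH[b' H]; exists b', I; split.
(* A gap at the bottom of an upward closed part [J] of [I] extends down to the bottom of [I]. *)
- have cut J : subpred J I -> (forall x y, J x -> I y -> lt x y -> J y) ->
    (exists b', realizes (fun=> True) J (false :: c) b') ->
    exists b', realizes (fun=> True) I (false :: c) b'.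
    move=> JI Jup [b' /= [J' [J'J J'up _ H]]]; exists b', J'; split=> //.
      by move=> x /J'J/JI.
    by move=> x y J'x Iy xy; apply: (J'up x) => //; apply: (Jup x) => //; apply: J'J.
  case: b0 => [[x [b' [_ Ix _ /IH]]]|[J [JI Jup _ /IH]]]; last exact: (cut J).
  apply: (cut [pred y | I y && lt x y]); first by move=> y /andP[].
  by move=> y z /andP[_ xy] Iz /(lt_trans xy) xz /=; rewrite Iz.
Qed.

(** The part of [I] below [J] is either unbounded, and forms one free gap, or it is listed point by
    point, by induction on a bound for its increasing tuples. *)
Lemma realizes_prepend (I J : pred nat) c a :
  subpred J I -> (forall x y, J x -> I y -> lt x y -> J y) ->
  realizes unbounded J c a ->
  exists c' a', realizes unbounded I (c' ++ c) (a' ++ a).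
Proof.
move=> JI Jup Ja; pose D := [pred x | I x && ~~ J x].
have [D_unb|] := pselect (unbounded D).
  by exists [:: false], [::]; exists J.
move=> /existsNP[n]; elim: n => [|n IH] in I JI Jup @D * => noD.
  by case: noD; exists [::].
have [[s [s_n ps Ds]]|{}noD] := pselect (exists s,
    [/\ size s = n, pairwise lt s & all D s]); last exact: (IH I).
case: s s_n ps Ds => [|x s] s_n ps Ds.
  have -> : I = J; last by exists [::], [::].
  apply/funext => x; apply/idP/idP => [Ix|/JI//].
  apply: contrapT => /negP nJx; apply: noD; exists [:: x].
  by rewrite -s_n /= Ix nJx.
have /andP[Dx _] := Ds; have /andP[Ix nJx] := Dx.
(* A [y] below [x] would prolong [x :: s], which already has the greatest possible length. *)
have minx y : I y -> ~~ lt y x.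
  move=> Iy; apply/negP => yx; apply: noD; exists [:: y, x & s].
  rewrite -s_n; split=> //=.
    move: ps => /= /andP[/allP xs ->]; rewrite yx !andbT /=.
    by rewrite andbC /=; apply/andP; split; apply/allP => z /xs; [|apply: lt_trans yx].
  apply/andP; split=> //; rewrite Iy /=.
  by apply: contra nJx => Jy; apply: (Jup y).
have [||noD'|c' [a' H]] := IH [pred y | I y && lt x y].
- move=> y Jy /=; rewrite JI //=.
  have /lt_total/orP[//|yx] : x != y by apply: contraNneq nJx => ->.
  by rewrite (Jup _ _ Jy Ix yx) in nJx.
- by move=> y z Jy /andP[Iz _]; apply: Jup.
- move: (noD') => [t [t_n pt /allP Dt]]; apply: noD; exists (x :: t); split=> /=.
  + by rewrite t_n.
  + by rewrite pt andbT; apply/allP => y /Dt /andP[/andP[]].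
  + rewrite Ix nJx; apply/allP => y /Dt /= /andP[/andP[-> _ ->]] //.
by exists (true :: c'), (x :: a'), x, (a' ++ a); split.
Qed.

(** Once the entries above [x] are covered, [x] is added as the least point of [J], and the part of
    [I] below it is prepended. *)
Lemma realizes_cover I a : pairwise lt a -> all I a ->
  exists c a', realizes unbounded I c a' /\ {subset a <= a'}.
Proof.
elim: a I => [|x a IH] I /=.
  move=> _ _.
  have [|||c [a' H]] := @realizes_prepend I xpred0 [::] [::] => //.
  by exists (c ++ [::]), (a' ++ [::]).
move=> /andP[/allP xa pa] /andP[Ix /allP Ia].
have [||c [a' [H aa']]] := IH [pred y | I y && lt x y] => //.
  by apply/allP => y ya /=; rewrite Ia // xa.
pose J := [pred y | I y && ~~ lt y x].
have [|||c' [a0 H']] := @realizes_prepend I J (true :: c) (x :: a').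
- by move=> y /andP[].
- move=> y z /andP[_ yx] Iz yz; rewrite /J /= Iz; apply: contra yx.
  exact: lt_trans.
- exists x, a'; split=> //; first by rewrite /J /= Ix lt_irr.
    by move=> y /= /andP[].
  have -> // : [pred y | J y && lt x y] = [pred y | I y && lt x y] :> pred nat.
  apply/funext => y /=; case xy: (lt x y); rewrite ?andbF ?andbT //.
  case: (I y) => //=; apply/negP => yx.
  by have := lt_trans xy yx; rewrite lt_irr.
exists (c' ++ true :: c), (a0 ++ x :: a'); split=> // y.
by rewrite inE mem_cat inE => /predU1P[->|/aa' ->]; rewrite ?eqxx ?orbT.
Qed.

Lemma mask_outside (J : pred nat) m s : size m = size s -> all J (mask m s) ->
  pairwise lt s -> (forall x y, J x -> y \in s -> lt x y -> J y) ->
  exists s1 s2 m2, [/\ s = s1 ++ s2, m = nseq (size s1) false ++ m2,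
    all (predC J) s1 & all J s2].
Proof.
elim: s m => [|x s IH] [|b m] //=.
  by exists [::], [::], [::].
move=> [m_s] Jm /andP[/allP xs ps] Jup.
have [Jx|nJx] := boolP (J x).
  exists [::], (x :: s), (b :: m); split=> //=.
  rewrite Jx; apply/allP => y ys; apply: (Jup x) => //; last exact: xs.
  by rewrite inE ys orbT.
case: b Jm => /=; first by rewrite (negbTE nJx).
move=> /(IH m m_s)[//|y z Jy zs|s1 [s2 [m2 [-> -> Js1 Js2]]]].
  by apply: Jup => //; rewrite inE zs orbT.
by exists (x :: s1), s2, m2; rewrite /= nJx.
Qed.

End Words.

(** Entries of [b] go to the entries of [a] in the same place, and the entries of [F] in a gap of
    [J] to an increasing tuple of equal length in the unbounded gap of [I]. So each finite extension
    of [b] is copied by an extension of [a]. *)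
Lemma realizes_match (lt lt' : rel nat) :
  irreflexive lt' -> transitive lt' ->
  (forall x y, x != y -> lt x y || lt y x) ->
  forall c I a J b, realizes lt (unbounded lt) I c a ->
  realizes lt' (fun=> True) J c b ->
  forall F m, size m = size F -> pairwise lt' F -> all J F -> mask m F = b ->
  exists F', [/\ size F' = size F, pairwise lt F', all I F' & mask m F' = a].
Proof.
move=> irr' trans' total; elim=> [|[] c IH] I a J b /=.
- move=> [-> I0] [-> J0] [|x F] m; last by move=> _ _ /=; rewrite J0.
  by case: m => // _ _ _ _; exists [::].
- move=> [x [a' [-> Ix minx Ia']]] [y [b' [-> Jy miny Jb']]] [|z F] [|h m] //=.
  move=> [m_F] /andP[/allP zF pF] /andP[Jz /allP JF] mF.
  (* [z] is least in [F], and [y], which occurs in [F], is least in [J]. *)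
  have zy : z = y.
    have : y \in z :: F.
      by apply: (@mem_mask _ _ (h :: m)); rewrite /= mF; case: (h) => //; rewrite mem_head.
    rewrite inE => /predU1P[//|/zF zy].
    by have := miny _ Jz; rewrite zy.
  case: h mF => [[_ mF]|mF]; last first.
    have : y \in F by apply: (@mem_mask _ _ m); rewrite mF mem_head.
    by move/zF; rewrite zy irr'.
  have [||F' [F'_F pF' /allP IF' mF']] := IH _ _ _ _ Ia' Jb' F m m_F pF.
  - by apply/allP => u uF /=; rewrite JF //= -zy zF.
  - exact: mF.
  exists (x :: F'); rewrite /= F'_F pF' Ix mF' !andbT; split=> //.
    by apply/allP => u /IF' /andP[].
  by apply/allP => u /IF' /andP[].
- move=> [I' [I'I I'up I'unb I'a]] [J' [J'J J'up _ J'b]] F m m_F pF JF mF.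
  have [_ J'b_all] := realizes_pairwise J'b.
  have [||s1 [s2 [m2 [FE mE Js1 Js2]]]] := @mask_outside lt' J' m F m_F _ pF.
  - by rewrite mF.
  - by move=> u v J'u vF; apply: J'up => //; apply: (allP JF).
  have m2_s2 : size m2 = size s2.
    by move: m_F; rewrite FE mE !size_cat size_nseq => /addnI.
  move: pF mF; rewrite FE mE pairwise_cat => /and3P[_ _ ps2].
  rewrite mask_cat ?size_nseq // mask_false /= => mF.
  have [F2 [F2_s2 pF2 IF2 mF2]] := IH _ _ _ _ I'a J'b _ _ m2_s2 ps2 Js2 mF.
  have [F1 [F1_s1 pF1 IF1]] := I'unb (size s1).
  exists (F1 ++ F2); rewrite !size_cat F1_s1 F2_s2; split=> //.
  + rewrite pairwise_cat pF1 pF2 !andbT; apply/allrelP => u v.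
    move=> /(allP IF1)/andP[Iu nI'u] /(allP IF2) I'v.
    have /total/orP[//|vu] : u != v by apply: contraNneq nI'u => ->.
    by rewrite (I'up _ _ I'v Iu vu) in nI'u.
  + rewrite all_cat; apply/andP; split; apply/allP => u; last by move/(allP IF2)/I'I.
    by move/(allP IF1)/andP => [].
  + by rewrite mask_cat ?size_nseq // mask_false.
Qed.

(** * Copies and locking tuples *)

Lemma map_tuple_comp n (f g : nat -> nat) (a : n.-tuple nat) :
  [tuple of map f [tuple of map g a]] = [tuple of map (f \o g) a].
Proof. by apply: val_inj; rewrite /= map_comp. Qed.

Lemma map_tuple_id n (f : nat -> nat) (a : n.-tuple nat) :
  f =1 id -> [tuple of map f a] = a.
Proof. by move=> f_id; apply: val_inj; rewrite /= (eq_map f_id) map_id. Qed.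

Lemma iso_sym L (A B : structure L) : iso A B -> iso B A.
Proof.
case=> f [g fK gK] AB; exists g; first by exists f.
move=> j a; rewrite AB map_tuple_comp map_tuple_id //.
Qed.

Lemma iso_trans L (A B D : structure L) : iso A B -> iso B D -> iso A D.
Proof.
move=> [f f_bij AB] [g g_bij BD]; exists (g \o f); first exact: bij_comp.
by move=> j a; rewrite AB BD map_tuple_comp.
Qed.

(** The copy of [A] in which the number [x] names the element [f x]; a permutation [f] is thus a
    numbering of [A]. *)
Definition pull L (A : structure L) (f : nat -> nat) : structure L :=
  fun j a => A j [tuple of map f a].

Lemma iso_pull L (A : structure L) f : bijective f -> iso (pull A f) A.
Proof. by move=> f_bij; exists f. Qed.

Lemma injective_extension (p : seq nat) : uniq p ->
  exists2 f : nat -> nat, bijective f & mkseq f (size p) = p.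
Proof.
elim/last_ind: p => [|p x IH]; first by exists id => //; exists id.
rewrite rcons_uniq => /andP[xp /IH[f f_bij fE]].
(* The transposition of [x] and [f (size p)] leaves the entries of [p] fixed. *)
pose t y := if y == x then f (size p) else if y == f (size p) then x else y.
have tK : involutive t.
  move=> y; rewrite /t; case: (eqVneq y x) => [->|yx].
    by rewrite eqxx; case: eqVneq.
  by case: (eqVneq y (f (size p))) => [->|/negbTE ->]; rewrite ?eqxx ?(negbTE yx).
exists (t \o f); first by apply: bij_comp => //; exists t.
rewrite size_rcons mkseqS.
have -> : (t \o f) (size p) = x by rewrite /= /t eqxx; case: eqVneq.
congr rcons; rewrite -[RHS]fE; apply/eq_in_map => i; rewrite mem_iota => /= ip.
have fip : f i \in p by rewrite -fE; apply/mapP; exists i; rewrite ?mem_iota.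
rewrite /t; case: eqVneq fip => [->|_ _]; first by rewrite (negbTE xp).
by rewrite (inj_eq (bij_inj f_bij)) ltn_eqF.
Qed.

Section Learning.

Variables (L : signature) (M : learner L).

(* The default tuple is observed at those [m] that encode no tuple. *)
Definition informant (X : structure L) (m : nat) : observation L :=
  fun j => let a := odflt [tuple of nseq (arity L j) 0] (unpickle m) in
           (a, `[< X j a >]).

Lemma informantP X : is_informant (informant X) X.
Proof.
move=> j a b; rewrite /informant; split=> [[m [<- <-]]|].
  by case: asboolP.
move=> Xa; exists (pickle a); rewrite pickleK /=; congr pair.
by case: b Xa => Xa; apply/asboolP.
Qed.

Definition answer (X : structure L) (s : nat) : option nat :=
  M (mkseq (informant X) s).

(** Continuity of the answer: the first [s] observations query finitely many tuples, and [N] exceeds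
    all their entries. *)
Lemma answer_local s : exists N, forall X Y : structure L,
  (forall j (a : (arity L j).-tuple nat), all (fun x => x < N) a ->
     X j a <-> Y j a) -> answer X s = answer Y s.
Proof.
suff [N NP] : exists N, forall X Y : structure L,
  (forall j (a : (arity L j).-tuple nat), all (fun x => x < N) a ->
     X j a <-> Y j a) -> mkseq (informant X) s = mkseq (informant Y) s.
  by exists N => X Y /NP; rewrite /answer => ->.
elim: s => [|s [N NP]]; first by exists 0.
pose ent j := tval (odflt [tuple of nseq (arity L j) 0] (unpickle s)).
pose N' := \max_j \max_(x <- ent j) x.+1.
exists (maxn N N') => X Y XY; rewrite !mkseqS; congr rcons.
  apply: NP => j a aN; apply: XY; apply: sub_all aN => x xN.
  by rewrite leq_max xN.
apply: functional_extensionality_dep => j; rewrite /informant; congr pair.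
apply/asbool_equiv_eq/XY/allP => x xa; rewrite leq_max; apply/orP; right.
apply: leq_trans (leq_bigmax j).
by rewrite (big_rem x) //= leq_maxl.
Qed.

(** The numberings that start with [p] form a basic open set of the space of permutations; [s0] and
    [e] are uniform on it. *)
Definition locks (A : structure L) (p : seq nat) (s0 e : nat) : Prop :=
  forall f, bijective f -> mkseq f (size p) = p ->
  forall s, s0 <= s -> answer (pull A f) s = Some e.

(** If no tuple locks, each tuple extends so as to force an answer other than [e] at some stage past
    [s0]. A generic numbering does so for all pairs, and the learner cannot converge on it. *)
Lemma exists_locks (A : structure L) :
  (forall f, bijective f -> exists e s0, forall s, s0 <= s ->
     answer (pull A f) s = Some e) ->
  exists p s0 e, uniq p /\ locks A p s0 e.
Proof.
move=> conv; apply: contrapT => unlocked.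
(* Stage [n] puts [n] into the range and defeats the [n]-th pair of a starting
   point and an answer; only the values below [x.2] of a state are final. *)
pose state := ({f : nat -> nat | bijective f} * nat)%type.
pose dec n : nat * nat := odflt (0, 0) (unpickle n).
pose good (n : nat) (x y : state) := exists s, [/\ (dec n).1 <= s,
  forall f, (forall i, i < y.2 -> f i = sval y.1 i) ->
    answer (pull A f) s <> Some (dec n).2,
  x.2 < y.2, (forall i, i < x.2 -> sval y.1 i = sval x.1 i)
  & exists2 i, i < y.2 & sval y.1 i = n].
have step (nx : nat * state) : exists y, good nx.1 nx.2 y.
  case: nx => n [[f f_bij] k] /=.
  have [f' [f'_bij f'E [s s_ge ans]]] : exists f', [/\ bijective f',
      forall i, i < k -> f' i = f i &
      exists2 s, (dec n).1 <= s & answer (pull A f') s <> Some (dec n).2].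
    apply: contrapT => none; apply: unlocked.
    exists (mkseq f k), (dec n).1, (dec n).2; split.
      by rewrite mkseq_uniq //; apply: bij_inj.
    move=> f' f'_bij f'E s s_ge; apply: contrapT => ans; apply: none.
    exists f'; split=> //; last by exists s.
    move=> i ik; move: f'E; rewrite size_mkseq => f'E.
    by rewrite -(nth_mkseq 0 f' ik) f'E nth_mkseq.
  have [N NP] := answer_local s.
  have [g f'K gK] := f'_bij.
  (* The new length exceeds [k] to make progress, [N] to fix the answer, and [g n] to put [n] into
     the range. *)
  exists (exist _ f' f'_bij, (maxn k (maxn N (g n))).+1), s; split=> //=.
  - move=> h hE; rewrite (NP _ (pull A f')) // => j a /allP aN.
    rewrite /pull; suff -> : [tuple of map h a] = [tuple of map f' a] by [].
    apply: val_inj; apply/eq_in_map => x /aN xN /=; apply: hE; lia.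
  - by lia.
  - by exists (g n); rewrite ?gK //; lia.
have [next nextP] := choice step.
have id_bij : bijective (@id nat) by exists id.
pose x := fix x n : state :=
  if n is n'.+1 then next (n', x n') else (exist _ id id_bij, 0).
have xP n : good n (x n) (x n.+1) := nextP (n, x n).
have x_ge n : n <= (x n).2.
  by elim: n => // n IH; have [s [_ _ /(leq_ltn_trans IH)]] := xP n.
have x_agree n m i : n <= m -> i < (x n).2 -> sval (x m).1 i = sval (x n).1 i.
  move=> /subnK <-; elim: (m - n) => // d IH ix; rewrite addSn.
  have [s [_ _ _ agree _]] := xP (d + n); rewrite agree ?IH //.
  elim: d {IH agree} => // d IH; apply: ltn_trans IH _.
  by rewrite addSn; have [? []] := xP (d + n).
(* Position [i] is final from stage [i.+1] on, by [x_ge]. *)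
pose F i := sval (x i.+1).1 i.
have FE n i : i < (x n).2 -> F i = sval (x n).1 i.
  move=> ix; rewrite /F; have [ni|ni] := leqP n i.+1; first exact: x_agree.
  by rewrite (x_agree i.+1 n) // ltnW.
have F_inj : injective F.
  move=> i j; pose n := (maxn i j).+1; have := x_ge n => n_ge.
  by rewrite !(FE n); [apply/bij_inj/(svalP (x n).1)|lia|lia].
have F_surj y : exists i, F i == y.
  have [s [_ _ _ _ [i ix iE]]] := xP y.
  by exists i; rewrite (FE y.+1) // iE.
have F_bij : bijective F.
  exists (fun y => xchoose (F_surj y)) => [i|y].
    by apply: F_inj; apply/eqP/(xchooseP (F_surj (F i))).
  exact/eqP/(xchooseP (F_surj y)).
have [e [s0 ans]] := conv F F_bij.
(* The stage coded by [(s0, e)] has defeated this very limit. *)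
have [s [s_ge noans _ _ _]] := xP (pickle (s0, e)).
have decE : dec (pickle (s0, e)) = (s0, e) by rewrite /dec pickleK.
rewrite decE in s_ge noans.
by case: (noans F _ (ans s s_ge)) => i ix; apply: FE.
Qed.

End Learning.

(** * Transfer between two linear orders *)

Definition ltr (A : structure order_sig) (x y : nat) : bool :=
  (x != y) && `[< order_rel A x y >].

Section Order.

Variables (A : structure order_sig) (A_linear : is_linear_order A).

Lemma ltr_irr : irreflexive (ltr A).
Proof. by move=> x; rewrite /ltr eqxx. Qed.

Lemma ltr_trans : transitive (ltr A).
Proof.
case: A_linear => _ anti trans _ y x z /andP[xy /asboolP Axy] /andP[yz /asboolP Ayz].
apply/andP; split; last by apply/asboolP; apply: trans Ayz.
by apply: contraNneq xy => xz; apply/eqP/anti => //; rewrite xz.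
Qed.

Lemma ltr_total x y : x != y -> ltr A x y || ltr A y x.
Proof.
case: A_linear => _ _ _ total xy; rewrite /ltr xy eq_sym xy /=.
by case: (total x y) => /asboolP ->; rewrite ?orbT.
Qed.

Lemma order_relE x y : order_rel A x y <-> (x == y) || ltr A x y.
Proof.
case: A_linear => Arefl _ _ _; rewrite /ltr; case: eqVneq => [->|xy] //=.
by split=> /asboolP.
Qed.

End Order.

Lemma mkseq_prefix (f : nat -> nat) n p r : size p <= n ->
  mkseq f n = p ++ r -> mkseq f (size p) = p.
Proof.
move=> pn /(congr1 (take (size p))); rewrite take_size_cat // => {2}<-.
by rewrite /mkseq -map_take take_iota (minn_idPl pn).
Qed.

Lemma locks_cat L (M : learner L) A p r s0 e :
  locks M A p s0 e -> locks M A (p ++ r) s0 e.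
Proof.
move=> lock f f_bij fE; apply: lock => //.
by apply: mkseq_prefix fE; rewrite size_cat leq_addr.
Qed.

(** Sends the entries of [s] to those of [s'] by position; only the values on [s] matter. *)
Definition transport (s s' : seq nat) (x : nat) : nat := nth 0 s' (index x s).

Lemma map_transport s s' : uniq s -> size s' = size s ->
  map (transport s s') s = s'.
Proof.
move=> us ss'; apply: (@eq_from_nth _ 0); rewrite size_map // => i i_s.
by rewrite (nth_map 0) // /transport index_uniq.
Qed.

Lemma order_sig_ext (X Y : structure order_sig) (N : nat) :
  (forall x y, x < N -> y < N -> order_rel X x y <-> order_rel Y x y) ->
  forall j (a : (arity order_sig j).-tuple nat), all (fun x => x < N) a ->
    X j a <-> Y j a.
Proof.
move=> XY j; rewrite (ord1 j) => /= a.
case/tupleP: a => x a; case/tupleP: a => y a; rewrite tuple0 => /= /and3P[xN yN _].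
suff -> : [tuple of x :: [tuple of y :: [tuple]]] = [tuple x; y] by apply: XY.
exact: val_inj.
Qed.

Lemma order_rel_pull (A : structure order_sig) f x y :
  order_rel (pull A f) x y <-> order_rel A (f x) (f y).
Proof.
rewrite /order_rel /pull.
by suff -> : [tuple of map f [tuple x; y]] = [tuple f x; f y] by []; apply: val_inj.
Qed.

Section SortedLists.

Variables (A : structure order_sig) (A_linear : is_linear_order A).

Let irr := @ltr_irr A.
Let trans := ltr_trans A_linear.
Let total := ltr_total A_linear.

Lemma pairwise_ltr_uniq s : pairwise (ltr A) s -> uniq s.
Proof. by move=> ps; apply: (sorted_uniq trans irr); rewrite sorted_pairwise. Qed.

Lemma ltr_index s x y : pairwise (ltr A) s -> x \in s -> y \in s ->
  ltr A x y = (index x s < index y s).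
Proof.
move=> ps xs ys.
have homo u v : u \in s -> v \in s -> index u s < index v s -> ltr A u v.
  move=> us vs uv; rewrite -(nth_index 0 us) -(nth_index 0 vs).
  by apply: (pairwiseP 0 ps); rewrite ?inE ?index_mem.
have [xy|yx|] := ltngtP (index x s) (index y s); first exact: homo.
  apply/negP => xy; have := trans xy (homo _ _ ys xs yx).
  by rewrite irr.
by move/(index_inj 0 xs ys) => ->; rewrite ?irr.
Qed.

Lemma exists_pairwise p : uniq p -> exists2 a, perm_eq a p & pairwise (ltr A) a.
Proof.
move=> up; pose le x y := (x == y) || ltr A x y.
have le_total : ssrbool.total le.
  by move=> x y; rewrite /le eq_sym; case: eqVneq => //= /total; rewrite orbC.
have le_trans : transitive le.
  move=> y x z; rewrite /le => /predU1P[->//|xy] /predU1P[<-|yz].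
    by rewrite xy orbT.
  by rewrite (trans xy yz) orbT.
exists (sort le p); first exact: permEl (perm_sort _ _).
have := sort_sorted le_total p; rewrite sorted_pairwise //.
have : uniq (sort le p) by rewrite sort_uniq.
rewrite uniq_pairwise => un le_p.
have : pairwise [rel x y | (x != y) && le x y] (sort le p).
  by rewrite pairwise_relI un.
by apply: sub_pairwise => x y /=; rewrite /le; case: eqVneq.
Qed.

End SortedLists.

(** In increasing lists the order is that of the positions, which [transport] preserves. *)
Lemma ltr_transport A B s s' x y : is_linear_order A -> is_linear_order B ->
  pairwise (ltr A) s -> pairwise (ltr B) s' -> size s' = size s ->
  x \in s -> y \in s ->
  ltr A x y = ltr B (transport s s' x) (transport s s' y) /\
  (x == y) = (transport s s' x == transport s s' y).
Proof.
move=> linA linB ps ps' ss' xs ys.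
have us' := pairwise_ltr_uniq linB ps'.
have mem u : u \in s -> transport s s' u \in s'.
  by move=> us; rewrite mem_nth // ss' index_mem.
have idx u : u \in s -> index (transport s s' u) s' = index u s.
  by move=> us; rewrite /transport index_uniq // ss' index_mem.
rewrite (ltr_index linA ps) // (ltr_index linB ps') ?mem // !idx //; split=> //.
apply/eqP/eqP => [->//|/(congr1 (index^~ s'))].
by rewrite !idx // => /(index_inj 0 xs ys).
Qed.

Lemma realizes_size_eq lt lt' (Q Q' : pred nat -> Prop) c I J a b :
  realizes lt Q I c a -> realizes lt' Q' J c b -> size a = size b.
Proof.
elim: c I J a b => [|[] c IH] I J a b /=.
- by move=> [-> _] [-> _].
- by move=> [x [a' [-> _ _ /IH{}IH]]] [y [b' [-> _ _ /IH /= ->]]].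
- by move=> [I' [_ _ _ /IH{}IH]] [J' [_ _ _ /IH]].
Qed.

(** Let [q] be the image of [p] under the map from [a] to [b]. For a numbering [h] of [B] starting
    with [q], matching carries a long prefix of [h] into [A] by an order isomorphism [psi] that
    takes [q] back to [p]. The image starts a numbering of [A], where the answer is locked, and at
    stage [s] the learner cannot tell the two copies apart. *)
Lemma locks_transfer (M : learner order_sig) A B c a b p s0 e :
  is_linear_order A -> is_linear_order B ->
  realizes (ltr A) (unbounded (ltr A)) predT c a ->
  realizes (ltr B) (fun=> True) predT c b ->
  perm_eq p a -> locks M A p s0 e -> exists2 q, uniq q & locks M B q s0 e.
Proof.
move=> linA linB Aa Bb pa lock.
have [pwa _] := realizes_pairwise Aa; have [pwb _] := realizes_pairwise Bb.
have ua := pairwise_ltr_uniq linA pwa; have ub := pairwise_ltr_uniq linB pwb.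
have size_ba := realizes_size_eq Bb Aa.
pose phi := transport a b.
have phi_a : map phi a = b by exact: map_transport.
have q_b : perm_eq (map phi p) b by rewrite -phi_a perm_map.
exists (map phi p); first by rewrite (perm_uniq q_b).
move=> h h_bij hE s s_ge.
have [N NP] := answer_local M s.
(* The prefix [w] is long enough to determine the answer and to contain [q]. *)
pose K := maxn N (size p); pose w := mkseq h K.
have wE : w = map phi p ++ drop (size p) w.
  rewrite -{1}(cat_take_drop (size p) w); congr cat; rewrite -hE size_map.
  by rewrite /w /mkseq -map_take take_iota (minn_idPl _) // leq_maxr.
have uw : uniq w by rewrite mkseq_uniq //; apply: bij_inj.
have [F Fw pwF] := exists_pairwise linB uw.
have uF : uniq F by rewrite (perm_uniq Fw).
pose m := map (mem (map phi p)) F.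
have mF : mask m F = b.
  rewrite /m -filter_mask; apply: (irr_sorted_eq (ltr_trans linB) (@ltr_irr B)).
  - apply: (sorted_filter (ltr_trans linB)).
    by rewrite sorted_pairwise //; apply: ltr_trans.
  - by rewrite sorted_pairwise //; apply: ltr_trans.
  - move=> x; rewrite mem_filter (perm_mem Fw) wE mem_cat /= -(perm_mem q_b).
    by case: (x \in map phi p).
have [|F' [F'F pwF' _ mF']] := realizes_match (@ltr_irr B) (ltr_trans linB)
  (ltr_total linA) Aa Bb (size_map _ _) pwF _ mF; first exact/allP.
pose psi := transport F F'.
have psi_F : map psi F = F' by exact: map_transport.
have psi_b : map psi b = a by rewrite -mF map_mask psi_F mF'.
have psi_q : map psi (map phi p) = p.
  have : map (psi \o phi) a = map id a by rewrite map_comp phi_a psi_b map_id.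
  move/eq_in_map => psiK; rewrite -map_comp -[RHS]map_id; apply/eq_in_map => x.
  by rewrite (perm_mem pa); apply: psiK.
have psi_w x y : x \in w -> y \in w ->
    ltr B x y = ltr A (psi x) (psi y) /\ (x == y) = (psi x == psi y).
  by rewrite -!(perm_mem Fw) => xF yF; apply: ltr_transport.
have upsi : uniq (map psi w).
  by rewrite map_inj_in_uniq // => x y xw yw /eqP; rewrite -(psi_w x y xw yw).2 => /eqP.
have [f f_bij fE] := injective_extension upsi.
have fpsi x : x < K -> f x = psi (h x).
  move=> xK; have := congr1 (nth 0 ^~ x) fE.
  rewrite nth_mkseq ?size_map ?size_mkseq ?size_iota //.
  by rewrite (nth_map 0) ?size_mkseq // nth_mkseq.
rewrite -(lock f f_bij _ s s_ge); last first.
  apply: (mkseq_prefix (n := K) (r := map psi (drop (size p) w))).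
    exact: leq_maxr.
  transitivity (map psi w); last by rewrite {1}wE map_cat psi_q.
  by rewrite -fE size_map size_mkseq.
apply/NP/order_sig_ext => x y xN yN; rewrite !order_rel_pull.
have xK : x < K by rewrite leq_max xN.
have yK : y < K by rewrite leq_max yN.
have hw z : z < K -> h z \in w by move=> zK; apply/mapP; exists z; rewrite ?mem_iota.
rewrite !order_relE // !fpsi //.
by have [-> ->] := psi_w _ _ (hw _ xK) (hw _ yK).
Qed.

Theorem theorem4p8
  (K : structure order_sig -> Prop)
  (K_closed : iso_closed K)
  (K_linear : forall A, K A -> is_linear_order A)
  (nu : nat -> structure order_sig)
  (nu_enum : effective_enumeration K nu)
  (C : structure order_sig -> Prop)
  (C_closed : iso_closed C)
  (C_sub_K : forall A, C A -> K A)
  (C_infinite : exists S : nat -> structure order_sig,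
      (forall i, C (S i)) /\ (forall i j, i <> j -> ~ iso (S i) (S j))) :
  ~ InfEx_learnable nu C.
Proof.
move=> [M learn]; have [S [CS S_niso]] := C_infinite.
have linS i : is_linear_order (S i) by apply/K_linear/C_sub_K.
have conv i f : bijective f -> exists e s0, iso (nu e) (S i) /\
    forall s, s0 <= s -> answer M (pull (S i) f) s = Some e.
  move=> f_bij; have pull_iso := iso_pull (S i) f_bij.
  have [e [s0 [nu_iso ans]]] :=
    learn _ (C_closed _ _ (iso_sym pull_iso) (CS i)) _ (informantP _).
  by exists e, s0; split=> //; apply: iso_trans pull_iso.
(* Some copy starts with [p], and there the locked answer is the limit, hence a correct index. *)
have locks_iso i p s0 e : uniq p -> locks M (S i) p s0 e -> iso (nu e) (S i).
  move=> /injective_extension[f f_bij fE] lock.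
  have [e' [s1 [nu_iso ans]]] := conv i f f_bij.
  have := lock f f_bij fE _ (leq_maxl s0 s1).
  by rewrite ans ?leq_maxr // => -[<-].
have words i : exists c, exists a p s0 e,
    [/\ realizes (ltr (S i)) (unbounded (ltr (S i))) predT c a,
        perm_eq p a & locks M (S i) p s0 e].
  have [|p [s0 [e [up lock]]]] := @exists_locks _ M (S i).
    by move=> f /(conv i)[e [s0 [_ ans]]]; exists e, s0.
  have [a0 a0p pwa0] := exists_pairwise (linS i) up.
  have [c [a [Sa a0a]]] := realizes_cover (@ltr_irr (S i)) (ltr_trans (linS i))
    (ltr_total (linS i)) pwa0 (all_predT _).
  have [pwa _] := realizes_pairwise Sa.
  have ua := pairwise_ltr_uniq (linS i) pwa.
  (* Appending to [p] the entries of [a] that it lacks gives a permutation of [a] that still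
     locks. *)
  exists c, a, (p ++ filter [predC p] a), s0, e.
  split=> //; last exact: locks_cat.
  have pa : {subset p <= a} by move=> x; rewrite -(perm_mem a0p) => /a0a.
  apply: uniq_perm => //.
    rewrite cat_uniq up filter_uniq // andbT /=; apply/hasPn => x.
    by rewrite mem_filter => /andP[].
  move=> x; rewrite mem_cat mem_filter /=.
  by case: (boolP (x \in p)) => [/pa ->|].
have [c cP] := choice words.
have [|i [j [ij cij]]] := @absorbs_good c.
  move=> n k ck; have [a [p [s0 [e [Sa _ _]]]]] := cP n; rewrite ck in Sa.
  (* A word of [k] points leaves room for [k] elements only, but the domain contains the [k.+1]
     numbers below [k.+1]. *)
  have [s sP pws] := exists_pairwise (linS n) (iota_uniq 0 k.+1).
  have := realizes_size (ltr_trans (linS n)) (ltr_total (linS n)) Sa pws (all_predT _).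
  by rewrite (perm_size sP) size_iota ltnn.
have [a [p [s0 [e [Sia pa lock]]]]] := cP i.
have [b [_ [_ [_ [Sjb _ _]]]]] := cP j.
have [b' Sjb'] := realizes_absorbs (ltr_trans (linS j)) cij (realizes_weaken Sjb).
have [q uq lockq] := locks_transfer (linS i) (linS j) Sia Sjb' pa lock.
have up : uniq p.
  by rewrite (perm_uniq pa); apply/(pairwise_ltr_uniq (linS i))/(proj1 (realizes_pairwise Sia)).
apply: (S_niso i j); first by move=> E; rewrite E ltnn in ij.
(* Both orders are locked on the same [e], hence isomorphic to [nu e]. *)
exact: iso_trans (iso_sym (locks_iso _ _ _ _ up lock)) (locks_iso _ _ _ _ uq lockq).
Qed.
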